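(* Let $a, d, k$ be positive integers with $2 \le k < a$ and $\gcd(a,d) = 1$, and let $S = \langle a, a + d, \ldots, a + kd\rangle$. Write $a - 1 = qk + r$ for $q, r \in \mathbb{Z}_{\ge 0}$ with $0 \le r < k$. Then $\Delta_\infty(S) = \{1, 2, \ldots, q + d + 1\}$.
   Context: $\langle b_0, \ldots, b_k\rangle$ denotes the set of all $\mathbb{Z}_{\ge 0}$-linear combinations of $b_0,\ldots,b_k$. For a numerical semigroup $S$ (a cofinite, additively closed subset of $\mathbb{Z}_{\ge 0}$ containing $0$) with minimal generators $b_0, \ldots, b_k$ (here $b_i = a + id$) and $x \in S$, the set of factorizations is $\mathsf Z(x) = \{z \in \mathbb{Z}_{\ge 0}^{k+1} : x = z_0b_0 + \cdots + z_kb_k\}$. For $z \in \mathsf Z(x)$, $\ell_\infty(z) = \max(z_0,\ldots,z_k)$; $\mathcal L_\infty(x) = \{\ell_\infty(z) : z \in \mathsf Z(x)\}$. Writing $\mathcal L_\infty(x) = \{c_1 < \cdots < c_r\}$, put $\Delta_\infty(x) = \{c_i - c_{i-1} : i = 2, \ldots, r\}$, and $\Delta_\infty(S) = \bigcup_{x \in S} \Delta_\infty(x)$. *)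

(* Defs.v *)
From mathcomp Require Import all_boot.
From mathcomp Require Import boolp classical_sets.

Set Implicit Arguments.
Unset Strict Implicit.
Unset Printing Implicit Defensive.

Local Open Scope classical_set_scope.
Local Open Scope nat_scope.

Definition lincomb (n : nat) (b : 'I_n -> nat) (z : {ffun 'I_n -> nat}) : nat :=
  \sum_(i < n) z i * b i.

Definition semigroup_gen (n : nat) (b : 'I_n -> nat) : set nat :=
  range (lincomb b).

Definition factorizations (n : nat) (b : 'I_n -> nat) (x : nat) :
    set {ffun 'I_n -> nat} :=
  [set z | x = lincomb b z].

Definition linf (n : nat) (z : {ffun 'I_n -> nat}) : nat := \max_(i < n) z i.

Definition linf_set (n : nat) (b : 'I_n -> nat) (x : nat) : set nat :=
  @linf n @` factorizations b x.

(* [c] is the increasing enumeration c_1 < ... < c_r of the length set; it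
   exists whenever all the generators are positive, since then [x] has only
   finitely many factorizations. *)
Definition delta_linf (n : nat) (b : 'I_n -> nat) (x : nat) : set nat :=
  [set t | exists c : seq nat,
     [/\ sorted ltn c,
         [set` c] = linf_set b x
       & exists2 i, 0 < i < size c & t = nth 0 c i - nth 0 c i.-1]].

(* Factorizations are taken with respect to the family [b], so this is the
   delta set of the semigroup generated by [b] when [b] is its minimal
   generating family. *)
Definition Delta_linf (n : nat) (b : 'I_n -> nat) : set nat :=
  \bigcup_(x in semigroup_gen b) delta_linf b x.

Definition arith_gens (a d k : nat) (i : 'I_k.+1) : nat := a + i * d.

Lemma arith_gens_minimal (a d k : nat) (z : {ffun 'I_k.+1 -> nat})
    (i : 'I_k.+1) :
  0 < d -> k < a -> coprime a d ->
  z i = 0 -> arith_gens a d i <> lincomb (@arith_gens a d k) z.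
Proof.
move=> d0 ka cad zi0; rewrite /arith_gens /lincomb => E.
pose m := \sum_(j < k.+1) z j; pose s := \sum_(j < k.+1) z j * j.
have {}E : a + i * d = m * a + s * d.
  rewrite E /m /s !big_distrl -big_split /=.
  by apply: eq_bigr => j _; rewrite mulnDr mulnA.
have ik : i <= k by rewrite -ltnS.
have a0 : 0 < a by apply: leq_ltn_trans ka.
have z_m j : z j <= m by rewrite /m (bigD1 j) //= leq_addr.
have m0 : 0 < m.
  rewrite lt0n; apply/eqP => m0; move: E.
  have -> : s = 0.
    by apply: big1 => j _; move: (z_m j); rewrite m0 leqn0 => /eqP ->.
  by rewrite m0 => /eqP; rewrite addn_eq0 (gtn_eqF a0).
move: E; rewrite -(prednK m0) mulSn -addnA => /addnI E.
have si : s <= i by rewrite -(leq_pmul2r d0) E leq_addl.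
have Ed : (i - s) * d = m.-1 * a by rewrite mulnBl E addnK.
have is0 : i - s = 0.
  apply/eqP; rewrite -leqn0 leqNgt; apply/negP => lt0.
  have : a <= i - s.
    by apply: dvdn_leq lt0 _; rewrite -(Gauss_dvdl _ cad) Ed dvdn_mull.
  by rewrite leqNgt (leq_ltn_trans (leq_subr _ _) (leq_ltn_trans ik ka)).
have /eqP m1 : m = 1.
  move/eqP: Ed; rewrite is0 mul0n eq_sym muln_eq0 (gtn_eqF a0) orbF => /eqP m1.
  by rewrite -(prednK m0) m1.
have {is0}si' : s = i by apply/eqP; rewrite eqn_leq si -subn_eq0 is0 eqxx.
have [j /andP[/eqP zj /forallP zj0]] :
    exists j, (z j == 1) && [forall l, (l != j) ==> (z l == 0)].
  have [j zj] : exists j, 0 < z j.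
    apply/existsP; apply: contraLR m0; rewrite negb_exists => /forallP z0.
    by rewrite -eqn0Ngt /m big1 // => l _; apply/eqP; rewrite eqn0Ngt z0.
  exists j; have := m1; rewrite /m (bigD1 j) //= -(prednK zj) addSn eqSS addn_eq0.
  rewrite sum_nat_eq0 => /andP[/eqP -> /forallP zl]; rewrite eqxx /=.
  by apply/forallP => l; exact: zl.
have sj : s = j.
  rewrite /s (bigD1 j) //= zj mul1n big1 ?addn0 // => l lj.
  by move: (zj0 l); rewrite lj => /eqP ->.
have ij : i = j by apply: val_inj; rewrite /= -si' sj.
by rewrite -ij zi0 in zj.
Qed.

(* Main.v *)
Require Import Defs.
From mathcomp Require Import all_boot.
From mathcomp Require Import boolp classical_sets.
From mathcomp Require Import zify.

Local Open Scope classical_set_scope.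
Local Open Scope nat_scope.

(** Write a factorization as a list of atom indices, so that one of length [m]
    whose indices add up to [s] has value [m * a + s * d].  As [a] and [d] are
    coprime, the pairs [(m, s)] occurring for a given element [x] form a single
    progression with step [(- d, + a)].

    Upper bound.  A trade that replaces at most [N] atoms by at most [N] atoms
    moves each multiplicity, hence the largest one, by at most [N].  Let
    [N = q + d + 1].  Any two factorizations of [x] are joined by such trades
    ([trade_connected]).  Those with the same [(m, s)] are joined by trades of
    two atoms that raise one index and lower another: all of them can be pushed
    to the same greedy factorization ([swap_greedy]).  Between [(m, s)] and
    [(m - d, s + a)] one uses a trade of the form

      [q + d] copies of [0], and [i]   <->   [q] copies of [k], and [r + 1 + i],

    valid because [a = q * k + r + 1]; an index [i <= k - r - 1] for which it
    applies exists whenever both pairs occur.  A gap larger than [N] between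
    consecutive values of the maximum would have to be crossed by one of these
    trades, which is impossible ([delta_leq]).

    Attaining every value.  Take [x = m * a + s * d] with [m] large compared
    to [s].  A factorization of [x] with largest multiplicity near [m] consists
    mostly of copies of the atom [a].  At lengths [>= m] there are at least
    [m - s] copies of it, and this is attained; at lengths [<= m - d] there are
    at most [m - d - C] with [C] the least integer [>= (s + a) / k], and this is
    attained as well.  Other atoms cannot reach such multiplicities at lengths
    [<= m - d], since they are larger than [a].  So [d + C - s] is a gap ([delta_large_element]).  At
    [s = 0] it equals [q + d + 1]; each unit step in [s] lowers it by at most
    one, and it is eventually nonpositive because [k >= 2], so it passes through
    every value in between ([gap_size_surjective]). *)

(** * Factorizations as lists of indices *)

Definition multiplicities (k : nat) (w : seq nat) : {ffun 'I_k.+1 -> nat} :=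
  [ffun i => count_mem (val i) w].

Definition value (a d : nat) (w : seq nat) : nat := size w * a + sumn w * d.

Notation bounded k := (all (geq k)).

Lemma lincomb_multiplicities (a d k : nat) (w : seq nat) :
  bounded k w -> lincomb (@arith_gens a d k) (multiplicities k w) = value a d w.
Proof.
rewrite /lincomb /value; elim: w => [_|x w IHw /= /andP[xk wk]].
  by apply: big1 => i _; rewrite ffunE.
transitivity (\sum_(i < k.+1)
    ((x == i) * (a + i * d) + multiplicities k w i * (a + i * d))).
  by apply: eq_bigr => i _; rewrite !ffunE /= mulnDl.
rewrite big_split /= (IHw wk) (bigD1 (Ordinal (xk : x < k.+1))) //= eqxx.
rewrite big1 => [|i]; first by lia.
by rewrite -val_eqE /= eq_sym => /negbTE ->.
Qed.

Lemma multiplicitiesP (k : nat) (z : {ffun 'I_k.+1 -> nat}) :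
  exists2 w, bounded k w & z = multiplicities k w.
Proof.
exists (flatten [seq nseq (z i) (val i) | i <- enum 'I_k.+1]).
  apply/allP => x /flatten_mapP[i _]; rewrite mem_nseq => /andP[_ /eqP ->].
  by rewrite /= -ltnS ltn_ord.
apply/ffunP => i; rewrite ffunE count_flatten -map_comp sumnE big_map big_enum /=.
rewrite (bigD1 i) //= count_nseq /= eqxx mul1n big1 ?addn0 // => j ji.
by rewrite count_nseq /= val_eqE (negbTE ji).
Qed.

Lemma leq_count_linf (k x : nat) (w : seq nat) :
  x <= k -> count_mem x w <= linf (multiplicities k w).
Proof.
move=> xk; have := @leq_bigmax _ (multiplicities k w) (Ordinal (xk : x < k.+1)).
by rewrite ffunE.
Qed.

Lemma linf_leq (k M : nat) (w : seq nat) :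
  (forall x, x <= k -> count_mem x w <= M) -> linf (multiplicities k w) <= M.
Proof.
by move=> wM; apply/bigmax_leqP => i _; rewrite ffunE; apply: wM; rewrite -ltnS ltn_ord.
Qed.

(** This transfers the whole problem from finite functions to lists, where
    trades are list surgery. *)
Lemma linf_setE (a d k x : nat) :
  linf_set (@arith_gens a d k) x =
  [set l | exists w, [/\ bounded k w, value a d w = x & linf (multiplicities k w) = l]].
Proof.
apply/seteqP; split => l /=.
  move=> [z zx <-]; have [w wk zE] := multiplicitiesP k z; exists w; split=> //.
    by rewrite -(lincomb_multiplicities _ _ k) // -zE zx.
  by rewrite zE.
move=> [w [wk wx <-]]; exists (multiplicities k w) => //.
by rewrite /factorizations /= lincomb_multiplicities.
Qed.

(** A multiplicity can grow only through the atoms put in. *)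
Lemma linf_trade_lipschitz (k N : nat) (u v v' w : seq nat) : size v <= N ->
  linf (multiplicities k (u ++ v ++ w)) <= linf (multiplicities k (u ++ v' ++ w)) + N.
Proof.
move=> vN; apply: linf_leq => x xk.
have := @leq_count_linf k x (u ++ v' ++ w) xk.
have := leq_trans (count_size (pred1 x) v) vN.
by rewrite !count_cat; lia.
Qed.

(** * Connecting factorizations by small trades *)

(** The factorization of length [n] and index sum [s] that takes the largest
    possible index at each turn, provided [s <= n * k]; it serves as the normal
    form of all factorizations with these two parameters. *)
Fixpoint greedy (k n s : nat) : seq nat :=
  if n is n'.+1 then minn k s :: greedy k n' (s - minn k s) else [::].

Lemma size_greedy k n s : size (greedy k n s) = n.
Proof. by elim: n s => //= n IHn s; rewrite IHn. Qed.

Lemma bounded_greedy k n s : bounded k (greedy k n s).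
Proof. by elim: n s => //= n IHn s; rewrite IHn /= geq_minl. Qed.

Lemma sumn_greedy k n s : s <= n * k -> sumn (greedy k n s) = s.
Proof.
by elim: n s => [|n IHn] s /= sk; [lia|rewrite IHn; lia].
Qed.

Lemma bounded_sumn k w : bounded k w -> sumn w <= size w * k.
Proof. by elim: w => //= x w IHw /andP[/= xk /IHw]; lia. Qed.

(** Connectedness is phrased through predicates: two lists are joined by swaps
    when no swap-invariant predicate separates them.  The prefix [u] makes the
    notion stable under fixing the first entry, which drives the induction in
    [swap_greedy]. *)
Definition swap_invariant (k : nat) (Q : seq nat -> Prop) : Prop :=
  forall u i j w, i < k -> j < k -> bounded k u -> bounded k w ->
    Q (u ++ [:: i.+1; j] ++ w) <-> Q (u ++ [:: i; j.+1] ++ w).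

Lemma swap_pair_iter k (P : seq nat -> Prop) n x y w : swap_invariant k P ->
  x + n <= k -> y + n <= k -> bounded k w ->
  P [:: x, y + n & w] <-> P [:: x + n, y & w].
Proof.
move=> Pswap; elim: n x => [|n IHn] x xk yk wk; first by rewrite !addn0.
have /= := Pswap [::] x (y + n) w; rewrite addnS => <- //; try lia.
by rewrite IHn ?addnS ?addSn //; lia.
Qed.

(** Make the tail greedy by induction, shift as much weight as possible from the
    second entry to the first, and make the tail greedy again.  Two entries are
    enough for the first one to reach its greedy value: the second entry of a list
    with greedy tail is either [k] or the sum of the whole tail. *)
Lemma swap_greedy k (P : seq nat -> Prop) w : swap_invariant k P ->
  bounded k w -> P w <-> P (greedy k (size w) (sumn w)).
Proof.
have [n] := ubnP (size w); elim: n => // n IHn in P w *.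
case: w => [|x w] //= wn Pswap /andP[/= xk wk].
(* A tail may be replaced by its greedy form behind any admissible entry. *)
have tl y v : y <= k -> bounded k v -> size v < n ->
    P (y :: v) <-> P (y :: greedy k (size v) (sumn v)).
  move=> yk vk vn; apply: (IHn (fun v => P (y :: v))) => // u i j t ik jk uk tk.
  by apply: (Pswap (y :: u)); rewrite //= yk.
rewrite tl //; case E: (size w) => [|m] /=.
  by case: w E {wk wn} => //= _; rewrite addn0 (minn_idPr xk).
set y := minn k (sumn w); set v := greedy k m _.
have vk : bounded k v := bounded_greedy _ _ _.
have wS : sumn w <= m.+1 * k by rewrite -E bounded_sumn.
have vs : sumn v = sumn w - y by apply: sumn_greedy; rewrite /y; lia.
pose M := minn k (x + sumn w).
have yk : y <= k := geq_minl _ _.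
have Mx : M = x + (M - x) by rewrite /M; lia.
have yE : y = (x + y - M) + (M - x) by rewrite /M /y; lia.
rewrite {1}yE (swap_pair_iter k) //; try by rewrite /M /y; lia.
rewrite -Mx tl /= ?size_greedy ?vk ?andbT; try by rewrite /M /y; lia.
by have -> : x + y - M + sumn v = x + sumn w - M by rewrite vs /M /y; lia.
Qed.

Lemma same_size_sum k (P : seq nat -> Prop) w w' : swap_invariant k P ->
  bounded k w -> bounded k w' -> size w = size w' -> sumn w = sumn w' ->
  P w <-> P w'.
Proof.
move=> Pswap wk wk' ww' sw; apply: iff_trans (swap_greedy k P w Pswap wk) _.
by rewrite ww' sw; symmetry; apply: swap_greedy.
Qed.

(** The same idea for all value-preserving trades of at most [N] atoms; since
    the two sides of a trade can be exchanged, one implication suffices. *)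
Definition trade_closed (a d k N : nat) (P : seq nat -> Prop) : Prop :=
  forall u v v' w, bounded k (u ++ v ++ w) -> bounded k v' ->
    size v <= N -> size v' <= N -> value a d v = value a d v' ->
    P (u ++ v ++ w) -> P (u ++ v' ++ w).

Lemma trade_swap a d k N (P : seq nat -> Prop) : 2 <= N ->
  trade_closed a d k N P -> swap_invariant k P.
Proof.
move=> N2 Ptr u i j w ik jk uk wk.
by split; apply: Ptr; rewrite /value ?all_cat /= ?uk ?wk //=; lia.
Qed.

(** Push both lists, within their length and sum, to lists that contain the
    two sides of the trade and agree on the rest [t].  Feasibility of [t] dictates
    [i]: the part of [sumn w] that [n] atoms of index at most [k] cannot carry. *)
Lemma adjacent_lengths a d k q r (P : seq nat -> Prop) w w' :
  0 < d -> r < k -> a - 1 = q * k + r -> 0 < a ->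
  trade_closed a d k (q + d + 1) P -> 0 < q ->
  bounded k w -> bounded k w' ->
  size w = size w' + d -> sumn w' = sumn w + a ->
  P w <-> P w'.
Proof.
move=> d0 rk aE a0 Ptr q0 wk wk' sz sm.
have N2 : 2 <= q + d + 1 by lia.
have Psw := trade_swap _ _ _ _ _ N2 Ptr.
have sk := bounded_sumn _ _ wk'.
have q_lt : q < size w'.
  by rewrite -(ltn_pmul2r (leq_ltn_trans (leq0n r) rk)); lia.
pose n := size w' - q.+1; have nE : size w' = n + q.+1 by rewrite /n; lia.
pose i := sumn w - n * k.
have ik : r.+1 + i <= k by rewrite /i; nia.
pose t := greedy k n (sumn w - i).
have tk : bounded k t := bounded_greedy _ _ _.
have ts : sumn t = sumn w - i by apply: sumn_greedy; rewrite /i; lia.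
have iw : i <= sumn w by rewrite /i; lia.
pose v := nseq (q + d) 0 ++ [:: i]; pose v' := nseq q k ++ [:: r.+1 + i].
have vk : bounded k v by rewrite all_cat all_nseq /= orbT /=; lia.
have vk' : bounded k v' by rewrite all_cat all_nseq /= leqnn orbT /= andbT.
have vz : size v = q + d + 1 by rewrite size_cat size_nseq.
have vz' : size v' = q + 1 by rewrite size_cat size_nseq.
have vs : sumn v = i by rewrite sumn_cat sumn_nseq /=; lia.
have vs' : sumn v' = i + a by rewrite sumn_cat sumn_nseq /=; lia.
have tz : size t = n := size_greedy _ _ _.
have -> : P w <-> P (v ++ t).
  apply: same_size_sum Psw wk _ _ _; first by rewrite all_cat vk.
    by rewrite size_cat; lia.
  by rewrite sumn_cat; lia.
have -> : P w' <-> P (v' ++ t).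
  apply: same_size_sum Psw wk' _ _ _; first by rewrite all_cat vk'.
    by rewrite size_cat; lia.
  by rewrite sumn_cat; lia.
have vv' : value a d v = value a d v' by rewrite /value vz vz' vs vs'; lia.
have vtk : bounded k (v ++ t) by rewrite all_cat vk.
have vtk' : bounded k (v' ++ t) by rewrite all_cat vk'.
by split; [apply: (Ptr [::] v v' t)|apply: (Ptr [::] v' v t)]; rewrite ?vz ?vz' //; lia.
Qed.

(** Coprimality of [a] and [d]: the lengths differ by a multiple of [d]. *)
Lemma value_eq a d w w' : coprime a d -> 0 < d -> size w' <= size w ->
  value a d w = value a d w' ->
  exists j, size w = size w' + j * d /\ sumn w' = sumn w + j * a.
Proof.
rewrite /value => cad d0 ww' E.
have D : (size w - size w') * a + sumn w * d = sumn w' * d.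
  by rewrite mulnBl; have := leq_mul ww' (leqnn a); lia.
have /dvdnP[j jE] : d %| size w - size w'.
  rewrite -(@Gauss_dvdl d _ a) 1?coprime_sym //.
  by rewrite -(dvdn_addl _ (dvdn_mull (sumn w) (dvdnn d))) D dvdn_mull.
exists j; split; first by lia.
by apply/eqP; rewrite -(eqn_pmul2r d0); apply/eqP; rewrite -D jE mulnAC addnC mulnDl.
Qed.

(** Go from one length to the other in steps of [d].  A length [m] and index sum
    [s] are realized as soon as [s <= m * k]; along the way [m] decreases and [s]
    increases, so the condition at the shorter end implies it everywhere. *)
Lemma trade_connected a d k q r (P : seq nat -> Prop) w w' :
  0 < d -> r < k -> a - 1 = q * k + r -> 0 < a -> coprime a d ->
  trade_closed a d k (q + d + 1) P -> 0 < q ->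
  bounded k w -> bounded k w' -> value a d w = value a d w' ->
  P w -> P w'.
Proof.
move=> d0 rk aE a0 cad Ptr q0 wk wk' E.
suff: P w <-> P w' by case.
wlog ww' : w w' wk wk' E / size w' <= size w.
  by case/orP: (leq_total (size w') (size w)) => ww' H; [|symmetry]; apply: H.
have [j [sz sm]] := value_eq _ _ _ _ cad d0 ww' E.
elim: j => [|j IHj] in w wk sz sm {E ww'} *.
  apply: same_size_sum => //; try lia.
  by apply: trade_swap Ptr; lia.
pose t := greedy k (size w' + j * d) (sumn w + a).
have tk : bounded k t := bounded_greedy _ _ _.
have tz : size t = size w' + j * d := size_greedy _ _ _.
have ts : sumn t = sumn w + a.
  by apply: sumn_greedy; have := bounded_sumn _ _ wk'; nia.
rewrite -(IHj t) //; last by lia.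
by apply: (adjacent_lengths a d k q r) => //; lia.
Qed.

(** * Gaps in the set of largest multiplicities *)

Lemma ltn_nth_sorted (c : seq nat) i j : sorted ltn c ->
  i < size c -> j < size c -> (nth 0 c i < nth 0 c j) = (i < j).
Proof.
move=> cs ic jc; have mono := sorted_ltn_nth ltn_trans 0 cs.
case: (ltngtP i j) => [ij|ji|->]; last by rewrite ltnn.
- by apply: mono.
- by apply/negbTE; rewrite -leqNgt ltnW //; apply: mono.
Qed.

(** The values are at most [x], so filtering an initial segment of the naturals
    enumerates them increasingly. *)
Lemma consecutive_delta a d k x u v :
  0 < a -> linf_set (@arith_gens a d k) x u -> linf_set (@arith_gens a d k) x v ->
  u < v ->
  (forall l, linf_set (@arith_gens a d k) x l -> l <= u \/ v <= l) ->
  delta_linf (@arith_gens a d k) x (v - u).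
Proof.
move=> a0 Lu Lv uv gap; set L := linf_set _ _ in Lu Lv gap *.
have Lx l : L l -> l <= x.
  rewrite /L linf_setE => -[w [_ <- <-]]; apply: linf_leq => y _.
  by apply: leq_trans (count_size _ _) (leq_trans (leq_pmulr _ a0) (leq_addr _ _)).
pose c := [seq l <- iota 0 x.+1 | `[< L l >]].
have cL l : (l \in c) = `[< L l >].
  rewrite mem_filter mem_iota /=; apply: andb_idr => /asboolP /Lx; lia.
have cs : sorted ltn c by apply: sorted_filter (iota_ltn_sorted _ _); exact: ltn_trans.
have uc : u \in c by rewrite cL; apply/asboolP.
have vc : v \in c by rewrite cL; apply/asboolP.
exists c; split=> //.
  by apply/seteqP; split => l /=; rewrite cL => /asboolP.
have iu : index u c < size c by rewrite index_mem.
have iv : index v c < size c by rewrite index_mem.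
have iuv : index u c < index v c by rewrite -(@ltn_nth_sorted c) // !nth_index.
exists (index v c); first by rewrite (leq_ltn_trans (leq0n _) iuv).
have pv : (index v c).-1 < size c by apply: leq_ltn_trans (leq_pred _) iv.
rewrite nth_index //; congr (_ - _).
have /asboolP Lp : `[< L (nth 0 c (index v c).-1) >] by rewrite -cL mem_nth.
have pv_lt : nth 0 c (index v c).-1 < v.
  by rewrite -{2}(nth_index 0 vc) ltn_nth_sorted //; lia.
have up : u <= nth 0 c (index v c).-1.
  by rewrite leqNgt -(nth_index 0 uc) ltn_nth_sorted //; lia.
by have := gap _ Lp; lia.
Qed.

(** The predicate of having largest multiplicity at most [nth 0 c i.-1] would be
    closed under the trades if the gap exceeded their size, although it separates
    the factorizations realizing the two ends of the gap. *)
Lemma delta_leq a d k q r x t :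
  0 < d -> r < k -> a - 1 = q * k + r -> 0 < a -> coprime a d -> 0 < q ->
  delta_linf (@arith_gens a d k) x t -> t <= q + d + 1.
Proof.
move=> d0 rk aE a0 cad q0 [c [cs cL [i /andP[i0 ic] ->]]].
have cP l : l \in c <-> linf_set (@arith_gens a d k) x l.
  by rewrite -cL.
have cn j : j < size c -> linf_set (@arith_gens a d k) x (nth 0 c j).
  by move=> jc; apply/cP/mem_nth.
have pc : i.-1 < size c by lia.
have := cn _ pc; rewrite linf_setE => -[w [wk wx wl]].
have := cn _ ic; rewrite linf_setE => -[w' [wk' wx' wl']].
rewrite leqNgt; apply/negP => tN.
pose P v := value a d v = x -> linf (multiplicities k v) <= nth 0 c i.-1.
suff /(_ wx') : P w' by rewrite wl'; lia.
apply: (trade_connected a d k q r P w) => //; [|by rewrite wx|by rewrite /P wl].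
move=> u v v' s; rewrite !all_cat => /and3P[uk vk sk] vk' vN vN' vv' Puvs x'E.
have xE : value a d (u ++ v ++ s) = x.
  by rewrite -x'E /value !size_cat !sumn_cat; move: vv'; rewrite /value; lia.
have := linf_trade_lipschitz k (q + d + 1) u v' v s vN'; have := Puvs xE.
set l := linf (multiplicities k (u ++ v' ++ s)) => lw lN.
have lc : l \in c.
  by apply/cP; rewrite linf_setE; exists (u ++ v' ++ s); rewrite !all_cat uk vk' sk.
have li : l < nth 0 c i by lia.
move: li; rewrite -(nth_index 0 lc) ltn_nth_sorted ?index_mem // => li.
rewrite leqNgt ltn_nth_sorted ?index_mem //; lia.
Qed.

Lemma delta_gt0 a d k x t : delta_linf (@arith_gens a d k) x t -> 0 < t.
Proof.
move=> [c [cs _ [i /andP[i0 ic] ->]]].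
by rewrite subn_gt0 ltn_nth_sorted //; lia.
Qed.

Lemma delta_semigroup n (b : 'I_n -> nat) x t :
  delta_linf b x t -> semigroup_gen b x.
Proof.
move=> [c [_ cL [i /andP[_ ic] _]]].
have : [set` c] (nth 0 c i) by apply: mem_nth.
by rewrite cL => -[z zx _]; exists z.
Qed.

(** * Elements realizing each gap *)

Lemma sumn_leq_nonzeros k w : bounded k w ->
  sumn w <= (size w - count_mem 0 w) * k.
Proof.
suff H : bounded k w -> exists p, size w = p + count_mem 0 w /\ sumn w <= p * k.
  by move=> /H[p [-> ?]]; rewrite addnK.
elim: w => [_|x w IHw /andP[/= xk /IHw[p [wp wk]]]]; first by exists 0.
by case: x xk => [|x] xk; [exists p|exists p.+1]; split;
  rewrite /= ?wp ?add1n ?addnS ?add0n ?addSn //; lia.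
Qed.

Lemma size_leq_zeros_sumn w : size w <= count_mem 0 w + sumn w.
Proof. by elim: w => //= x w IHw; case: x => [|x] /=; lia. Qed.

Lemma count_value x a d w : count_mem x w * (a + x * d) <= value a d w.
Proof.
rewrite /value; elim: w => //= y w IHw; have [->|_] /= := eqVneq y x; nia.
Qed.

(** The lower bound on [m] serves to keep the multiplicities of the indices
    [> 0] at most [m - (d + C)]: multiplied by [a + d], they cannot exceed the
    value [m * a + s * d]. *)
Lemma delta_large_element a d k s C t m :
  0 < d -> 2 <= k -> 0 < a -> coprime a d ->
  s + a <= C * k -> C.-1 * k < s + a -> s + t = d + C -> 0 < t ->
  2 * s + (a + d) * (d + C) + (d + C) <= m ->
  delta_linf (@arith_gens a d k) (m * a + s * d) t.
Proof.
move=> d0 k2 a0 cad sC Cs tE t0 mE.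
have sm : 2 * s + (d + C) <= m.
  by apply: leq_trans mE; rewrite leq_add2r leq_addr.
have -> : t = (m - s) - (m - (d + C)) by lia.
have lin x : x <= k -> forall w, count_mem x w <= linf (multiplicities k w).
  by move=> xk w; apply: leq_count_linf.
(* Here [p] below is first the number of zeros, then the multiplicity of a
   positive index, of a list of length at most [m - d]. *)
have tops w : bounded k w -> s + a <= sumn w -> size w <= m - d ->
    value a d w = m * a + s * d -> linf (multiplicities k w) <= m - (d + C).
  move=> wk ws wz wx; apply: linf_leq => -[|x] xk.
    have := sumn_leq_nonzeros _ _ wk; have := count_size (pred1 0) w : _ <= @size nat w.
    set p := count_mem 0 w => pw wp.
    have : C.-1 < size w - p by rewrite -(@ltn_pmul2r k); lia.
    by lia.
  have := count_value x.+1 a d w; rewrite wx; set p := count_mem _ _ => px.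
  rewrite leqNgt; apply/negP => mp.
  have {}px : (m - (d + C)).+1 * (a + d) <= m * a + s * d.
    by apply: leq_trans px; apply: leq_mul => //; rewrite leq_add2l leq_pmull.
  have Dm : d + C <= m by lia.
  have nE : 2 * s + (a + d) * (d + C) <= m - (d + C) by lia.
  rewrite -{2}(subnK Dm) in px; move: (d + C) (m - (d + C)) nE px => D n nE px.
  have := leq_mul nE (leqnn d); have := leq_pmulr (D * a) d0.
  by have := leq_pmulr (D * d) d0; lia.
apply: consecutive_delta => //.
- rewrite linf_setE.
  pose w := nseq (m - (d + C)) 0 ++ greedy k C (s + a).
  have wk : bounded k w by rewrite all_cat bounded_greedy all_nseq /= orbT.
  have ws : sumn w = s + a by rewrite sumn_cat sumn_nseq sumn_greedy.
  have wz : size w = m - d by rewrite size_cat size_nseq size_greedy; lia.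
  have wx : value a d w = m * a + s * d
    by rewrite /value ws wz mulnBl; have := leq_mul (_ : d <= m) (leqnn a); lia.
  exists w; split=> //; apply/eqP; rewrite eqn_leq tops ?ws ?wz //=.
  apply: leq_trans (lin 0 _ w) => //.
  by rewrite count_cat count_nseq /=; lia.
- rewrite linf_setE.
  pose w := nseq (m - s) 0 ++ nseq s 1.
  have wk : bounded k w by rewrite all_cat !all_nseq /= !orbT /=; lia.
  exists w; split=> //.
    by rewrite /value size_cat sumn_cat !size_nseq !sumn_nseq subnK; lia.
  apply/eqP; rewrite eqn_leq; apply/andP; split.
    apply: linf_leq => x _; rewrite count_cat !count_nseq /=.
    by case: x => [|[|x]] /=; lia.
  by apply: leq_trans (lin 0 _ w) => //; rewrite count_cat count_nseq /=; lia.
- by lia.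
move=> l; rewrite linf_setE => -[w [wk wx <-]].
have wx' : value a d w = value a d (nseq (m - s) 0 ++ nseq s 1).
  by rewrite wx /value size_cat sumn_cat !size_nseq !sumn_nseq subnK; lia.
have vz : size (nseq (m - s) 0 ++ nseq s 1) = m.
  by rewrite size_cat !size_nseq; lia.
have vs : sumn (nseq (m - s) 0 ++ nseq s 1) = s.
  by rewrite sumn_cat !sumn_nseq; lia.
have [mw|wm] := leqP m (size w).
  right; have [|j [_]] := value_eq a d w _ cad d0 _ wx'; first by rewrite vz.
  rewrite vs => sj; apply: leq_trans (lin 0 _ w) => //.
  rewrite leq_subLR addnC; apply: leq_trans mw (leq_trans (size_leq_zeros_sumn w) _).
  by rewrite leq_add2l sj leq_addr.
left; have [|j []] := value_eq a d _ w cad d0 _ (esym wx').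
  by rewrite vz ltnW.
rewrite vz vs => mj wj; have j0 : 0 < j by case: j mj {wj} => //; lia.
by apply: tops => //; have := leq_pmull a j0; have := leq_pmull d j0; lia.
Qed.

(** Discrete intermediate value theorem, applied to the least [s] at which the
    gap [d + C - s] is no larger than [t]; [C] is the ceiling of [(s + a) / k]. *)
Lemma gap_size_surjective a d k q r t :
  2 <= k -> r < k -> a - 1 = q * k + r -> 0 < a -> 0 < t <= q + d + 1 ->
  exists s C, [/\ s + a <= C * k, C.-1 * k < s + a & s + t = d + C].
Proof.
move=> k2 rk aE a0 /andP[t0 tN].
pose C s := ((s + a - 1) %/ k).+1.
have C_ub s : s + a <= C s * k.
  by have := ltn_ceil (s + a - 1) (ltnW k2); rewrite /C; lia.
have C_lb s : (C s).-1 * k < s + a.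
  by have := leq_divM (s + a - 1) k; rewrite /C /=; lia.
have exs : exists s, d + C s <= s + t.
  by exists (2 * (d + a + 1)); have := C_lb (2 * (d + a + 1)); rewrite /C /=; nia.
case: (ex_minnP exs) => s sP smin; exists s, (C s); split=> //.
case: s => [|s] in sP smin *.
  have : q < C 0 by have := C_ub 0; rewrite -(@ltn_pmul2r k); nia.
  by lia.
have := smin s; have : C s <= C s.+1 by rewrite ltnS leq_div2r //; lia.
by lia.
Qed.

Theorem theorem3p2 (a d k q r : nat) (a_gt0 : 0 < a) (d_gt0 : 0 < d)
    (k_ge2 : 2 <= k) (k_lt_a : k < a) (gcd_ad : gcdn a d = 1)
    (a1_eq : a - 1 = q * k + r) (r_lt_k : r < k) :
  Delta_linf (@arith_gens a d k) = [set t : nat | 1 <= t <= q + d + 1].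
Proof.
have cad : coprime a d by rewrite /coprime gcd_ad.
have q_gt0 : 0 < q by case: q a1_eq => //; lia.
apply/seteqP; split => t /=.
  move=> [x _ xt]; rewrite (delta_gt0 _ _ _ _ _ xt) /=.
  by apply: (delta_leq a d k q r x).
move=> tN; have [s [C [sC Cs tE]]] :=
  gap_size_surjective _ d _ _ _ _ k_ge2 r_lt_k a1_eq a_gt0 tN.
have /andP[t_gt0 _] := tN.
have Dx := delta_large_element _ _ _ _ _ _ _
  d_gt0 k_ge2 a_gt0 cad sC Cs tE t_gt0 (leqnn _).
by eexists; [exact: delta_semigroup Dx|exact: Dx].
Qed.
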